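(* Let $r\ge2$, let $C\subset S^{D-1}$ be a kissing configuration, and let $B\subset C$ be nonempty. There exists an equal-latitude lifting in $\mathbb{R}^{D+k}$ replacing every direction of $B$ by copies at the same $r$ tails, with $0<h^2<1/2$, if and only if $$k\ge r-1\qquad\text{and}\qquad\langle x,x'\rangle\le\frac1{r+1}\quad\text{for all distinct }x,x'\in B .$$ No pure-tail points are required, i.e. the set $Y$ in the definition of the lifting may be empty. In particular, when distinct elements of $B$ have inner product at most $1/(r+1)$, there is a kissing configuration in $\mathbb{R}^{D+r-1}$ with $|C|+(r-1)|B|$ points, obtained by replacing each direction of $B$ by $r$ copies with tails of squared norm $(r-1)/(2r)$.
   Context: A kissing configuration in $S^{n-1}\subset\mathbb{R}^n$ is a set of unit vectors whose distinct members have inner product at most $\tfrac12$. An equal-latitude lifting in $\mathbb{R}^{D+k}=\mathbb{R}^D\oplus\mathbb{R}^k$ replacing every direction of $B$ by copies at the same $r$ tails consists of a number $h>0$, distinct vectors (tails) $t_1,\dots,t_r\in\mathbb{R}^k$ with $\|t_i\|=h$ for all $i$, and a (possibly empty) kissing configuration $Y\subset S^{k-1}$, such that $$\{(x,0):x\in C\setminus B\}\cup\{(\sqrt{1-h^2}\,x,t_i):x\in B,\ 1\le i\le r\}\cup\{(0,y):y\in Y\}$$ is a kissing configuration. *)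

(* Defs.v *)
From mathcomp Require Import all_boot all_order all_algebra.
From mathcomp Require Import all_classical all_reals.

Set Implicit Arguments.
Unset Strict Implicit.
Unset Printing Implicit Defensive.

Import Order.TTheory GRing.Theory Num.Theory.

Local Open Scope classical_set_scope.
Local Open Scope ring_scope.

(* The library's inner product on row vectors, [dotmx], requires a
   [numClosedFieldType], and the norm of ['rV[R]_n] in MathComp-Analysis is the
   sup norm, so the Euclidean structure of R^n is introduced here. *)
Definition dotv (R : realType) (n : nat) (u v : 'rV[R]_n) : R :=
  \sum_(i < n) u ord0 i * v ord0 i.

Definition enorm (R : realType) (n : nat) (u : 'rV[R]_n) : R :=
  Num.sqrt (dotv u u).

(* S^(n-1), the unit sphere of R^n; empty for n = 0. *)
Definition usphere {R : realType} {n : nat} : set 'rV[R]_n :=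
  [set u | enorm u = 1].

Definition kissing (R : realType) (n : nat) (A : set 'rV[R]_n) : Prop :=
  A `<=` usphere /\
  (forall x y, A x -> A y -> x <> y -> dotv x y <= 1 / 2).

(* [row_mx x t] is the vector (x, t) of R^D (+) R^k.  [Num.sqrt] is 0 on
   negative numbers; if h > 1 the set below contains a vector (0, t i) of norm
   h when [B] and ['I_r] are inhabited, so it is then not a kissing
   configuration. *)
Definition lifted_set (R : realType) (D k r : nat) (C B : set 'rV[R]_D)
    (h : R) (t : 'I_r -> 'rV[R]_k) (Y : set 'rV[R]_k) : set 'rV[R]_(D + k) :=
  [set row_mx x 0 | x in C `\` B] `|`
  [set z | exists x i, B x /\ z = row_mx (Num.sqrt (1 - h ^+ 2) *: x) (t i)] `|`
  [set row_mx 0 y | y in Y].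

Definition equal_latitude_lifting (R : realType) (D k r : nat)
    (C B : set 'rV[R]_D) (h : R) (t : 'I_r -> 'rV[R]_k) (Y : set 'rV[R]_k)
    : Prop :=
  [/\ 0 < h,
      injective t,
      (forall i, enorm (t i) = h),
      kissing Y &
      kissing (lifted_set C B h t Y)].

(* Main.v *)
(* Two copies of the same direction have inner product (1 - h^2) + <t_i, t_j>,
   so <t_i, t_j> <= h^2 - 1/2 < 0; r vectors with pairwise negative inner
   products span dimension at least r - 1, and |sum_i t_i|^2 >= 0 forces
   h^2 >= (r - 1) / (2 r).  Copies of distinct x, x' with the same tail satisfy
   (1 - h^2) <x, x'> + h^2 <= 1/2, and (1/2 - h^2) / (1 - h^2) decreases in h^2,
   with value 1 / (r + 1) at the minimal height.  Conversely, the tails are taken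
   to be the vertices of the centred regular simplex of squared radius
   (r - 1) / (2 r). *)
Require Import Defs.
From mathcomp Require Import all_boot all_order all_algebra.
From mathcomp Require Import all_classical all_reals.
From mathcomp Require Import ring lra.

Import Order.TTheory GRing.Theory Num.Theory.

Local Open Scope classical_set_scope.
Local Open Scope card_scope.
Local Open Scope ring_scope.

Set Implicit Arguments.
Unset Strict Implicit.

(** * Bilinearity and positivity of the Euclidean inner product *)

Lemma dotv_mulmx (R : realType) (n : nat) (u v : 'rV[R]_n) :
  dotv u v = (u *m v^T) ord0 ord0.
Proof. by rewrite mxE; apply: eq_bigr => i _; rewrite mxE. Qed.

Lemma dotvC (R : realType) (n : nat) (u v : 'rV[R]_n) : dotv u v = dotv v u.
Proof. by apply: eq_bigr => i _; rewrite mulrC. Qed.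

Lemma dotvDl (R : realType) (n : nat) (u v w : 'rV[R]_n) :
  dotv (u + v) w = dotv u w + dotv v w.
Proof. by rewrite !dotv_mulmx mulmxDl mxE. Qed.

Lemma dotvZl (R : realType) (n : nat) (a : R) (u w : 'rV[R]_n) :
  dotv (a *: u) w = a * dotv u w.
Proof. by rewrite !dotv_mulmx -scalemxAl mxE. Qed.

Lemma dotvDr (R : realType) (n : nat) (u v w : 'rV[R]_n) :
  dotv w (u + v) = dotv w u + dotv w v.
Proof. by rewrite dotvC dotvDl !(dotvC w). Qed.

Lemma dotvZr (R : realType) (n : nat) (a : R) (u w : 'rV[R]_n) :
  dotv w (a *: u) = a * dotv w u.
Proof. by rewrite dotvC dotvZl (dotvC w). Qed.

Lemma dotv0l (R : realType) (n : nat) (w : 'rV[R]_n) : dotv 0 w = 0.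
Proof. by rewrite dotv_mulmx mul0mx mxE. Qed.

Lemma dotv0r (R : realType) (n : nat) (w : 'rV[R]_n) : dotv w 0 = 0.
Proof. by rewrite dotvC dotv0l. Qed.

Lemma dotv_suml (R : realType) (n m : nat) (F : 'I_m -> 'rV[R]_n) (w : 'rV[R]_n) :
  dotv (\sum_i F i) w = \sum_i dotv (F i) w.
Proof.
rewrite dotv_mulmx mulmx_suml summxE.
by apply: eq_bigr => i _; rewrite dotv_mulmx.
Qed.

Lemma dotv_sumr (R : realType) (n m : nat) (F : 'I_m -> 'rV[R]_n) (w : 'rV[R]_n) :
  dotv w (\sum_i F i) = \sum_i dotv w (F i).
Proof. by rewrite dotvC dotv_suml; apply: eq_bigr => i _; rewrite dotvC. Qed.

Lemma dotv_row_mx (R : realType) (m n : nat) (u u' : 'rV[R]_m) (v v' : 'rV[R]_n) :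
  dotv (row_mx u v) (row_mx u' v') = dotv u u' + dotv v v'.
Proof. by rewrite !dotv_mulmx tr_row_mx mul_row_col mxE. Qed.

Lemma dotv_ge0 (R : realType) (n : nat) (u : 'rV[R]_n) : 0 <= dotv u u.
Proof. by apply: sumr_ge0 => i _; rewrite -expr2 sqr_ge0. Qed.

Lemma dotv_eq0 (R : realType) (n : nat) (u : 'rV[R]_n) : dotv u u = 0 -> u = 0.
Proof.
move=> u0; apply/rowP => i; rewrite mxE; apply/eqP; rewrite -sqrf_eq0 expr2.
move/eqP: u0; rewrite psumr_eq0 => [/allP/(_ i)|j _]; last by rewrite -expr2 sqr_ge0.
by rewrite mem_index_enum => /(_ isT).
Qed.

Lemma enorm_sqr (R : realType) (n : nat) (u : 'rV[R]_n) :
  enorm u ^+ 2 = dotv u u.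
Proof. by rewrite sqr_sqrtr ?dotv_ge0. Qed.

Lemma usphereE (R : realType) (n : nat) (u : 'rV[R]_n) :
  usphere u <-> dotv u u = 1.
Proof.
rewrite /usphere /= /enorm; split => [u1|->]; last by rewrite sqrtr1.
by rewrite -[dotv u u]sqr_sqrtr ?dotv_ge0 // u1 expr1n.
Qed.

(** * Families with negative inner products, and regular simplices *)

(* If [\sum_i c_i s_i = 0], passing to absolute values can only decrease the
   squared norm, so [\sum_i `|c_i| s_i = 0] too, which contradicts the negative
   inner products with the vector left out of the relation. *)
Lemma negative_family_card (R : realType) (n k : nat) (t : 'I_n.+1 -> 'rV[R]_k) :
  (forall i j, i != j -> dotv (t i) (t j) < 0) -> (n <= k)%N.
Proof.
move=> tN; rewrite leqNgt; apply/negP => ltkn.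
(* The last vector is held back; the other [n > k] vectors are linearly dependent. *)
pose s i := t (lift ord_max i).
pose A : 'M[R]_(n, k) := \matrix_(i < n) s i.
have: kermx A != 0.
  rewrite kermx_eq0 /row_free; apply/eqP => rA.
  by move: (rank_leq_col A); rewrite rA leqNgt ltkn.
move=> /rowV0Pn[c /sub_kermxP cA c0].
have cs0 : \sum_i c ord0 i *: s i = 0.
  rewrite -[RHS]cA mulmx_sum_row; apply: eq_bigr => i _.
  by rewrite rowK.
pose u := \sum_i `|c ord0 i| *: s i.
have u0 : u = 0.
  apply: dotv_eq0; apply: le_anti; rewrite dotv_ge0 andbT.
  have -> : 0 = dotv (\sum_i c ord0 i *: s i) (\sum_i c ord0 i *: s i).
    by rewrite cs0 dotv0l.
  rewrite /u !dotv_suml; apply: ler_sum => i _.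
  rewrite !dotv_sumr; apply: ler_sum => j _.
  rewrite !dotvZl !dotvZr !mulrA -normrM.
  have [<-|ij] := eqVneq i j; first by rewrite ger0_norm // -expr2 sqr_ge0.
  rewrite ler_wnM2r ?ler_norm // ltW // tN //.
  by apply: contra ij => /eqP/lift_inj->.
have : dotv u (t ord_max) < 0.
  have /rV0Pn[i0 ci0] := c0.
  have neg i : dotv (s i) (t ord_max) < 0 by apply: tN; rewrite eq_sym neq_lift.
  rewrite /u dotv_suml (bigD1 i0) //= ltr_wnDr //.
    by apply: sumr_le0 => i _; rewrite dotvZl mulr_ge0_le0 // ltW.
  by rewrite dotvZl pmulr_rlt0 ?normr_gt0.
by rewrite u0 dotv0l ltxx.
Qed.

(* The vertices are [e_i + a 1] for [i < n] and [b 1], with [1] the all-ones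
   vector; [a] and [b] solve [n a^2 + 2 a = - s^2] and [b (1 + n a) = - s^2]. *)
Lemma simplex_exists (R : realType) (n : nat) : (0 < n)%N ->
  exists v : 'I_n.+1 -> 'rV[R]_n,
    forall i j, dotv (v i) (v j) = (i == j)%:R - n.+1%:R^-1.
Proof.
move=> n0; pose N : R := n%:R.
have N0 : N != 0 by rewrite pnatr_eq0 -lt0n.
have N1 : N + 1 != 0 by rewrite natr1 pnatr_eq0.
(* The last vertex must have squared norm [n b^2 = n / (n + 1)], so [b = - s] is possible; then
   [1 + n a = s] determines [a]. *)
pose s : R := Num.sqrt (N + 1)^-1.
have s2 : s ^+ 2 = (N + 1)^-1 by rewrite sqr_sqrtr // invr_ge0 natr1 ler0n.
have sN : s ^+ 2 * N = 1 - s ^+ 2 by rewrite s2; field.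
pose a : R := (s - 1) / N.
have aN : a * N = s - 1 by rewrite /a; field.
pose o : 'rV[R]_n := const_mx 1.
pose d (i : 'I_n) : 'rV[R]_n := delta_mx ord0 i.
have dd i j : dotv (d i) (d j) = (i == j)%:R.
  rewrite /dotv (bigD1 i) //= big1 => [|l li]; last first.
    by rewrite !mxE (negPf li) mul0r.
  by rewrite !mxE !eqxx mul1r addr0.
have dO i : dotv (d i) o = 1.
  rewrite /dotv (bigD1 i) //= big1 => [|l li]; last first.
    by rewrite !mxE (negPf li) mul0r.
  by rewrite !mxE !eqxx mul1r addr0.
have od i : dotv o (d i) = 1 by rewrite dotvC.
have oo : dotv o o = N.
  rewrite /dotv (eq_bigr (fun=> 1)) ?sumr_const ?card_ord //.
  by move=> i _; rewrite !mxE mul1r.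
exists (fun i => if unlift ord_max i is Some i' then d i' + a *: o else - s *: o).
rewrite -natr1 -/N -s2 => i j.
(* Multiplying by [N] leaves only the product [a * N = s - 1]. *)
have aa : 2 * a + a * (a * N) = - s ^+ 2.
  have : N * (2 * a + a * (a * N)) = - (s ^+ 2 * N).
    by rewrite sN; transitivity (2 * (a * N) + (a * N) ^+ 2); [ring|rewrite aN; ring].
  by move=> e; apply: (mulfI N0); rewrite e; ring.
case: unliftP => [i' ->|->]; case: unliftP => [j' ->|->];
  rewrite !(dotvDl, dotvDr, dotvZl, dotvZr, dd, dO, od, oo).
- by rewrite (inj_eq lift_inj) -aa; ring.
- rewrite eq_sym (negPf (neq_lift _ _)) sub0r.
  by transitivity (- s * (1 + a * N)); [ring | rewrite aN; ring].
- rewrite (negPf (neq_lift _ _)) sub0r.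
  by transitivity (- s * (1 + a * N)); [ring | rewrite aN; ring].
- by rewrite eqxx; transitivity (s ^+ 2 * N); [ring | rewrite sN].
Qed.

(** Scaling by [sqrt (1 / 2)] gives, for [r = n + 1], squared radius [(r - 1) / (2 r)] and mutual
    inner products [- 1 / (2 r)]; zero coordinates fill up the dimension to [k]. *)
Lemma scaled_simplex_exists (R : realType) (n k : nat) :
  (0 < n)%N -> (n <= k)%N ->
  exists t : 'I_n.+1 -> 'rV[R]_k,
    forall i j, dotv (t i) (t j) = ((i == j)%:R - n.+1%:R^-1) / 2.
Proof.
move=> n0 /subnKC <-; have [v vE] := simplex_exists R n0.
exists (fun i => row_mx (Num.sqrt 2^-1 *: v i) 0) => i j.
rewrite dotv_row_mx dotv0l addr0 dotvZl dotvZr vE mulrA -expr2.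
by rewrite sqr_sqrtr ?invr_ge0 ?ler0n // mulrC.
Qed.

(** * Finiteness of kissing configurations *)

Lemma dotv_sub_ge1 (R : realType) (n : nat) (A : set 'rV[R]_n) (x y : 'rV[R]_n) :
  kissing A -> A x -> A y -> x <> y -> 1 <= dotv (x - y) (x - y).
Proof.
move=> [A1 A2] Ax Ay xy; have := A2 _ _ Ax Ay xy.
move/usphereE: (A1 _ Ax) => xx; move/usphereE: (A1 _ Ay) => yy.
rewrite -[- y]scaleN1r !(dotvDl, dotvDr, dotvZl, dotvZr) xx yy (dotvC y x).
lra.
Qed.

Lemma usphere_coord (R : realType) (n : nat) (x : 'rV[R]_n) (i : 'I_n) :
  usphere x -> `|x ord0 i| <= 1.
Proof.
move=> /usphereE x1; rewrite -(@expr_le1 _ 2) // real_normK ?num_real // expr2 -x1.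
by rewrite /dotv (bigD1 i) //= lerDl sumr_ge0 // => j _; rewrite -expr2 sqr_ge0.
Qed.

(* Points in the same cell of a grid of mesh [1 / n.+1] are at squared distance
   at most [n / n.+1 ^ 2 < 1]. *)
Lemma kissing_finite (R : realType) (n : nat) (A : set 'rV[R]_n) :
  kissing A -> finite_set A.
Proof.
move=> kA; pose N : R := n.+1%:R.
have N0 : 0 < N by rewrite ltr0n.
(* Coordinates lie in [[-1, 1]], so [f] takes values in [[0, 2 (n + 1)]] on [A]; the truncations
   thus stay in the range where [inord] does not fall back to its default. *)
pose f (x : 'rV[R]_n) i := N * (x ord0 i + 1).
pose cell x : {ffun 'I_n -> 'I_(n.+1 * 2).+1} := [ffun i => inord (Num.truncn (f x i))].
pose g q := xget 0 [set x | A x /\ cell x = q].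
have f0 x i : A x -> 0 <= f x i.
  move=> Ax; rewrite mulr_ge0 ?(ltW N0) //.
  by have := usphere_coord i (kA.1 _ Ax); rewrite ler_norml; lra.
have cellE x i : A x -> cell x i = Num.truncn (f x i) :> nat.
  move=> Ax; rewrite ffunE inordK // ltnS -(ler_nat R).
  apply: (@le_trans _ _ (f x i)); first by rewrite truncn_le f0.
  rewrite natrM ler_wpM2l ?(ltW N0) //.
  by have := usphere_coord i (kA.1 _ Ax); rewrite ler_norml; lra.
(* It suffices that each point of [A] is the representative chosen by [g] for its cell, since there
   are finitely many cells. *)
apply: (@sub_finite_set _ _ (g @` setT)); last first.
  by apply: finite_image; exact: finite_finset.
move=> x Ax; exists (cell x) => //; rewrite /g.
case: xgetP => [y _ [Ay cxy]|/(_ x)]; last by case.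
apply/eqP/negPn/negP => /eqP yx.
have := dotv_sub_ge1 kA Ay Ax yx.
apply/negP; rewrite -ltNge -(ltr_pM2l (exprn_gt0 2 N0)) mulr1.
apply: (@le_lt_trans _ _ n%:R); last first.
  by rewrite -natrX ltr_nat expnS expn1 (leq_trans (ltnSn _)) // leq_pmulr.
rewrite /dotv mulr_sumr -[leRHS](_ : \sum_(i < n) 1 = _); last first.
  by rewrite sumr_const card_ord.
apply: ler_sum => i _; rewrite !mxE.
have := truncn_itv (f0 y i Ay); have := truncn_itv (f0 x i Ax).
rewrite -!cellE // cxy -natr1 => /andP[x1 x2] /andP[y1 y2].
have : `|f y i - f x i| <= 1 by rewrite ler_norml; lra.
rewrite -(@expr_le1 _ 2) // real_normK ?num_real //; apply: le_trans.
by rewrite le_eqVlt; apply/orP; left; apply/eqP; rewrite /f; ring.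
Qed.

(** * Cardinality through duplicate-free lists *)

Lemma card_uniq_seq (T : eqType) (s : seq T) : uniq s -> [set` s] #= `I_(size s).
Proof.
case: s => [|x0 s']; first by rewrite set_nil /= II0.
set s := x0 :: s' => us.
have -> : [set` s] = [set nth x0 s i | i in `I_(size s)].
  apply/seteqP; split => x /=; first by move/(nthP x0) => [i ? <-]; exists i.
  by case=> i ? <-; exact: mem_nth.
apply: inj_card_eq => i j; rewrite !inE /= => ilt jlt /eqP.
by rewrite nth_uniq // => /eqP.
Qed.

Lemma finite_uniq_seq (T : choiceType) (A : set T) :
  finite_set A -> exists2 s : seq T, uniq s & A = [set` s].
Proof.
move=> /finite_seqP[s ->]; exists (undup s); first exact: undup_uniq.
by apply/seteqP; split => x /=; rewrite mem_undup.
Qed.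

(** * Inner products of scaled directions, and necessity of the two conditions *)

Lemma sqrt_scale_dotv (R : realType) (D : nat) (h : R) (x y : 'rV[R]_D) :
  h ^+ 2 <= 1 ->
  dotv (Num.sqrt (1 - h ^+ 2) *: x) (Num.sqrt (1 - h ^+ 2) *: y) =
    (1 - h ^+ 2) * dotv x y.
Proof. by move=> h1; rewrite dotvZl dotvZr mulrA -expr2 sqr_sqrtr ?subr_ge0. Qed.

Section Necessity.
Variables (R : realType) (D k r : nat) (C B : set 'rV[R]_D) (h : R).
Variables (t : 'I_r -> 'rV[R]_k) (Y : set 'rV[R]_k).
Hypotheses (kC : kissing C) (BC : B `<=` C) (B0 : B !=set0).
Hypotheses (L : equal_latitude_lifting C B h t Y) (h12 : h ^+ 2 < 1 / 2).

Let h1 : h ^+ 2 <= 1. Proof. by have := h12; lra. Qed.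

Let lifted x i : B x ->
  lifted_set C B h t Y (row_mx (Num.sqrt (1 - h ^+ 2) *: x) (t i)).
Proof. by move=> Bx; left; right; exists x, i. Qed.

Lemma tail_sqr i : dotv (t i) (t i) = h ^+ 2.
Proof. by case: L => _ _ th _ _; rewrite -enorm_sqr th. Qed.

Lemma tail_dotv_le i j : i != j -> dotv (t i) (t j) <= h ^+ 2 - 1 / 2.
Proof.
move=> ij; case: L => _ tinj _ _ [_ kis]; have [x Bx] := B0.
have neq : row_mx (Num.sqrt (1 - h ^+ 2) *: x) (t i) <>
           row_mx (Num.sqrt (1 - h ^+ 2) *: x) (t j).
  by move/eq_row_mx => [_ /tinj/eqP]; apply/negP.
have := kis _ _ (lifted i Bx) (lifted j Bx) neq.
rewrite dotv_row_mx sqrt_scale_dotv // ((usphereE x).1 _) ?mulr1; last exact/kC.1/BC.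
by lra.
Qed.

Lemma dimension_ge : (r - 1 <= k)%N.
Proof.
(* For [r = 0] the truncated difference [r - 1] is [0]. *)
move: t tail_dotv_le; case: r => [//|n] t' tN; rewrite subn1.
apply: (@negative_family_card _ _ _ t') => i j ij.
by apply: le_lt_trans (tN i j ij) _; have := h12; lra.
Qed.

(* Expand [0 <= dotv (\sum_i t i) (\sum_i t i)]. *)
Lemma tail_sqr_ge : (0 < r)%N -> (r%:R - 1) / 2 <= r%:R * h ^+ 2.
Proof.
move=> r0; have rR : 0 < r%:R :> R by rewrite ltr0n.
(* After multiplication by [r], the difference of the two sides equals [r] times the bound [row]
   below. *)
rewrite -(ler_pM2l rR) -subr_ge0.
have := dotv_ge0 (\sum_i t i); move/le_trans; apply.
rewrite dotv_suml.
have row i : dotv (t i) (\sum_j t j) <= h ^+ 2 + (r%:R - 1) * (h ^+ 2 - 1 / 2).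
  rewrite dotv_sumr (bigD1 i) //= tail_sqr lerD2l.
  have -> : (r%:R - 1) * (h ^+ 2 - 1 / 2) = \sum_(j < r | j != i) (h ^+ 2 - 1 / 2).
    rewrite sumr_const cardC1 card_ord -[RHS]mulr_natl.
    by rewrite -[in LHS](prednK r0) -natr1 addrK.
  by apply: ler_sum => j ji; apply: tail_dotv_le; rewrite eq_sym.
apply: (le_trans (ler_sum _ (fun i _ => row i))).
rewrite sumr_const card_ord -[leLHS]mulr_natl le_eqVlt; apply/orP; left.
by apply/eqP; field.
Qed.

Lemma base_separated : (0 < r)%N ->
  forall x x', B x -> B x' -> x <> x' -> dotv x x' <= 1 / r.+1%:R.
Proof.
have hlt := h12; move=> r0 x x' Bx Bx' xx'; case: L => _ _ _ _ [_ kis].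
have c0 : Num.sqrt (1 - h ^+ 2) != 0 by rewrite sqrtr_eq0 -ltNge; lra.
pose i := Ordinal r0.
have neq : row_mx (Num.sqrt (1 - h ^+ 2) *: x) (t i) <>
           row_mx (Num.sqrt (1 - h ^+ 2) *: x') (t i).
  by move/eq_row_mx => [/(scalerI c0)].
have := kis _ _ (lifted i Bx) (lifted i Bx') neq.
rewrite dotv_row_mx sqrt_scale_dotv // tail_sqr => le.
have rR : 0 < r%:R + 1 :> R by rewrite natr1 ltr0n.
(* The bound [(1/2 - h^2) (r + 1) <= 1 - h^2] is equivalent to [(r - 1) / 2 <= r h^2], which is
   [tail_sqr_ge]. *)
rewrite -natr1 ler_pdivlMr // -(@ler_pM2l _ (1 - h ^+ 2)); last by lra.
rewrite mulrA mulr1; have := tail_sqr_ge r0.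
have : (1 - h ^+ 2) * dotv x x' * (r%:R + 1) <= (1 / 2 - h ^+ 2) * (r%:R + 1).
  by rewrite ler_pM2r //; lra.
lra.
Qed.

End Necessity.

(** * The lifting along simplex tails *)

Section Sufficiency.
Variables (R : realType) (D k r : nat) (C B : set 'rV[R]_D).
Variable t : 'I_r -> 'rV[R]_k.
Hypotheses (r2 : (2 <= r)%N) (kC : kissing C) (BC : B `<=` C).
Hypothesis B_sep : forall x x', B x -> B x' -> x <> x' -> dotv x x' <= 1 / r.+1%:R.
Hypothesis tE : forall i j, dotv (t i) (t j) = ((i == j)%:R - r%:R^-1) / 2.

Let q : R := r%:R^-1.
Let h : R := Num.sqrt ((r%:R - 1) / (2 * r%:R)).

Let rR : 2 <= r%:R :> R. Proof. by rewrite ler_nat. Qed.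

Let q0 : 0 < q. Proof. by rewrite invr_gt0; have := rR; lra. Qed.

Let q1 : q <= 1 / 2.
Proof. by rewrite -(ler_pM2l (_ : 0 < r%:R)) ?divff //; have := rR; lra. Qed.

Lemma height_sqr : h ^+ 2 = (1 - q) / 2.
Proof.
have r2' := rR; rewrite sqr_sqrtr; last by apply: divr_ge0; lra.
by rewrite /q; field; apply: lt0r_neq0; lra.
Qed.

Lemma simplex_lifting : equal_latitude_lifting C B h t set0.
Proof.
have [h2 r2' q_gt0 q_le] := And4 height_sqr rR q0 q1.
have h0 : 0 < h by rewrite sqrtr_gt0; apply: divr_gt0; lra.
have hle1 : h ^+ 2 <= 1 by lra.
have tt i : dotv (t i) (t i) = h ^+ 2 by rewrite tE eqxx h2.
have tij i j : i != j -> dotv (t i) (t j) = - q / 2.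
  by move=> /negPf ij; rewrite tE ij sub0r.
(* With [q = 1 / r], the separation bound [1 / (r + 1)] is [q / (1 + q)], and
   [1 - h^2 = (1 + q) / 2]. *)
have sep x x' : B x -> B x' -> x <> x' -> (1 + q) * dotv x x' <= q.
  move=> Bx Bx' /(B_sep Bx Bx').
  rewrite -natr1 ler_pdivlMr; last by lra.
  have -> : (1 + q) * dotv x x' = q * (dotv x x' * (r%:R + 1)).
    by rewrite /q; field; apply: lt0r_neq0; lra.
  by move=> le; rewrite -[leRHS]mulr1 ler_pM2l.
have c01 : 0 <= Num.sqrt (1 - h ^+ 2) <= 1.
  by rewrite sqrtr_ge0 /= -[leRHS]sqrtr1 ler_wsqrtr //; lra.
have tinj : injective t.
  move=> i j e; apply/eqP/negPn/negP => ij.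
  by have := tij _ _ ij; rewrite -e tt; lra.
have sphB x : B x -> dotv x x = 1 by move=> Bx; apply/usphereE/kC.1/BC.
have CB x x' : C x -> ~ B x -> B x' -> dotv x x' <= 1 / 2.
  by move=> Cx nBx Bx'; apply: kC.2 => //; [exact: BC | move=> e; rewrite e in nBx].
(* A factor in [[0, 1]] preserves the upper bound [1/2], whatever the sign of the inner product. *)
have CBc x x' : C x -> ~ B x -> B x' -> Num.sqrt (1 - h ^+ 2) * dotv x x' <= 1 / 2.
  by move=> Cx nBx Bx'; have := CB _ _ Cx nBx Bx'; case/andP: c01; nra.
split => //.
- by move=> i; rewrite /enorm tt sqrtr_sqr gtr0_norm.
- by split => [y|x y] [].
split.
  move=> z [[[x [Cx _] <-]|[x [i [Bx ->]]]]|[y []]]; apply/usphereE.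
    by rewrite dotv_row_mx dotv0l addr0; apply/usphereE/kC.1.
  by rewrite dotv_row_mx sqrt_scale_dotv // sphB // tt mulr1 subrK.
move=> z z' [[[x [Cx nBx] <-]|[x [i [Bx ->]]]]|[y []]] [[[x' [Cx' nBx'] <-]|[x' [j [Bx' ->]]]]|[y []]] //;
  rewrite dotv_row_mx => zz'.
- rewrite dotv0l addr0; apply: kC.2 => // e.
  by rewrite e in zz'.
- by rewrite dotv0l addr0 dotvZr CBc.
- by rewrite dotv0r addr0 dotvZl dotvC CBc.
rewrite sqrt_scale_dotv //.
(* Same direction, distinct tails: exactly [(1 + q) / 2 - q / 2 = 1/2]. Distinct directions: at most
   [q / 2 + (1 - q) / 2 = 1/2] for a common tail, and at most [q / 2 - q / 2 = 0] otherwise. *)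
have [e|xx'] := pselect (x = x'); have [ij|ij] := eqVneq i j.
- by rewrite e ij in zz'.
- by rewrite -e sphB // tij //; lra.
- by have := sep _ _ Bx Bx' xx'; rewrite ij tt h2; lra.
- by have := sep _ _ Bx Bx' xx'; rewrite tij // h2; lra.
Qed.

End Sufficiency.

(** * Number of points of the lifting *)

Lemma lifted_set_card (R : realType) (D k r : nat) (C B : set 'rV[R]_D)
    (h : R) (t : 'I_r -> 'rV[R]_k) :
  (0 < r)%N -> kissing C -> B `<=` C -> 0 < h -> h ^+ 2 < 1 -> injective t ->
  (forall i, enorm (t i) = h) ->
  exists m p : nat,
    [/\ C #= `I_m, B #= `I_p & lifted_set C B h t set0 #= `I_(m + (r - 1) * p)].
Proof.
move=> r0 kC BC h0 h1 tinj th; have finC := kissing_finite kC.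
have [u uniq_u uE] := finite_uniq_seq (finite_setD B finC).
have [v uniq_v vE] := finite_uniq_seq (sub_finite_set BC finC).
have CE : C = [set` u ++ v].
  apply/seteqP; split => x /=; rewrite mem_cat.
    move=> Cx; have [Bx|nBx] := pselect (B x).
      by move: Bx; rewrite vE /= => ->; rewrite orbT.
    by have : (C `\` B) x by []; rewrite uE /= => ->.
  case/orP => [xu|xv]; first by have [] : (C `\` B) x by rewrite uE.
  by apply: BC; rewrite vE.
have disj x : x \in u -> x \notin v.
  move=> xu; apply/negP => xv; have [_] : (C `\` B) x by rewrite uE.
  by apply; rewrite vE.
(* A nonzero factor keeps copies of distinct directions distinct; nonzero tails separate the copies
   from the points [(x, 0)]. *)
have c0 : Num.sqrt (1 - h ^+ 2) != 0 by rewrite sqrtr_eq0 -ltNge; lra.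
have t0 i : t i != 0.
  apply/eqP => ti0; have := th i.
  by rewrite ti0 /enorm dotv0l sqrtr0 => h00; rewrite -h00 ltxx in h0.
pose w := [seq row_mx x 0 | x <- u] ++
  [seq row_mx (Num.sqrt (1 - h ^+ 2) *: x) (t i) | x <- v, i <- enum 'I_r].
have wE : lifted_set C B h t set0 = [set` w].
  apply/seteqP; split => z /=; rewrite mem_cat.
    case=> [[[x xCB <-]|[x [i [Bx ->]]]]|[y []]].
      by apply/orP; left; apply: map_f; move: xCB; rewrite -/((C `\` B) x) uE.
    by apply/orP; right; apply: allpairs_f; [move: Bx; rewrite vE|exact: mem_enum].
  case/orP => [/mapP[x xu ->]|/allpairsP[[x i] /= [xv _ ->]]].
    by left; left; exists x => //; rewrite uE.
  by left; right; exists x, i; rewrite vE.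
exists (size u + size v)%N, (size v).
(* Here [u] lists the unreplaced directions and [v] the replaced ones, so [w] has
   [size u + r * size v] entries. *)
have -> : (size u + size v + (r - 1) * size v = size w)%N.
  rewrite /w size_cat size_map size_allpairs size_enum_ord -addnA -mulSn.
  by rewrite subn1 prednK // mulnC.
split.
- rewrite CE -size_cat; apply: card_uniq_seq; rewrite cat_uniq uniq_u uniq_v andbT.
  by apply/hasPn => x xv; apply/negP => /disj; rewrite xv.
- by rewrite vE; exact: card_uniq_seq.
rewrite wE; apply: card_uniq_seq; rewrite cat_uniq; apply/and3P; split.
- by rewrite map_inj_uniq // => x y /eq_row_mx[].
- apply/hasPn => z /allpairsP[[x i] /= [_ _ ->]]; apply/negP => /mapP[y _].
  by move/eq_row_mx => [_ /eqP]; apply/negP.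
apply: allpairs_uniq => //; first exact: enum_uniq.
move=> [x i] [y j] _ _ /= /eq_row_mx[/(scalerI c0) -> /tinj ->].
by [].
Qed.

(** * The equivalence, and the point count in dimension [D + r - 1] *)

Unset Implicit Arguments.

Theorem proposition2p4 (R : realType) (D r : nat) (hr : (2 <= r)%N)
    (C B : set 'rV[R]_D) (hC : kissing C) (hBC : B `<=` C) (hB : B !=set0) :
  let B_separated :=
    forall x x', B x -> B x' -> x <> x' -> dotv x x' <= 1 / r.+1%:R in
  [/\ (* the equivalence *)
      (forall k : nat,
        (exists (h : R) (t : 'I_r -> 'rV[R]_k) (Y : set 'rV[R]_k),
           equal_latitude_lifting C B h t Y /\ 0 < h ^+ 2 < 1 / 2) <->
        ((r - 1 <= k)%N /\ B_separated)),
      (* the set of pure-tail points may be taken empty *)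
      (forall k : nat,
        (r - 1 <= k)%N -> B_separated ->
        exists (h : R) (t : 'I_r -> 'rV[R]_k),
          equal_latitude_lifting C B h t set0 /\ 0 < h ^+ 2 < 1 / 2) &
      (* the configuration in dimension D + r - 1 *)
      (B_separated ->
        exists (h : R) (t : 'I_r -> 'rV[R]_(r - 1)) (m p : nat),
          [/\ equal_latitude_lifting C B h t set0,
              (forall i, enorm (t i) ^+ 2 = (r%:R - 1) / (2 * r%:R)),
              C #= `I_m,
              B #= `I_p &
              lifted_set C B h t set0 #= `I_(m + (r - 1) * p)])].

Proof.
move=> B_separated; have r0 : (0 < r)%N := ltnW hr.
have rR : 2 <= r%:R :> R by rewrite ler_nat.
(* The least height allowed by [tail_sqr_ge]; it serves for every [k >= r - 1]. *)
pose h0 : R := Num.sqrt ((r%:R - 1) / (2 * r%:R)).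
have lifting k : (r - 1 <= k)%N -> B_separated ->
    exists t : 'I_r -> 'rV[R]_k,
      equal_latitude_lifting C B h0 t set0.
  move=> rk sep; have r10 : (0 < r - 1)%N by rewrite subn_gt0.
  have := scaled_simplex_exists R r10 rk; rewrite subn1 prednK // => -[t tE].
  by exists t; exact: simplex_lifting.
have hsqr : h0 ^+ 2 = (r%:R - 1) / (2 * r%:R).
  by rewrite sqr_sqrtr //; apply: divr_ge0; lra.
have hbound : 0 < h0 ^+ 2 < 1 / 2.
  rewrite hsqr divr_gt0 /=; [|lra|lra].
  by rewrite ltr_pdivrMr; lra.
split=> [k|k rk sep|sep].
- split=> [[h [t [Y [L /andP[_ h12]]]]]|[rk sep]].
    split; first exact: (dimension_ge hC hBC hB L h12).
    exact: (base_separated hC hBC hB L h12 r0).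
  by have [t L] := lifting k rk sep; exists h0, t, set0.
- by have [t L] := lifting k rk sep; exists h0, t.
have [t L] := lifting _ (leqnn _) sep; case: (L) => h0_gt0 tinj th _ _.
have [|m [p [Cm Bp Lmp]]] := lifted_set_card r0 hC hBC h0_gt0 _ tinj th.
  by case/andP: hbound; lra.
by exists h0, t, m, p; split=> // i; rewrite th hsqr.
Qed.
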